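(* Let $n\geqslant 1$, let $w,w'\in S_n$, and let $\alpha=\mathsf{code}(w)$, $\alpha'=\mathsf{code}(w')$. Then $w$ covers $w'$ in the (strong) Bruhat order with $w'=w\cdot(i,j)$ (where $i<j$) if and only if $\alpha$ covers $\alpha'$ in positions $(i,j)$.
   Context: Notation: $[n]=\{1,\dots,n\}$ and $[a,b]=\{a,a+1,\dots,b\}$ for integers $a\leqslant b$. $S_n$ is the symmetric group, generated by the simple transpositions $s_i=(i,i+1)$, $i\in[n-1]$; $\ell(w)$ is the length (minimal number of simple transpositions in a product equal to $w$, equivalently the number of inversions). Permutations are written in one-line notation $w=w(1)w(2)\cdots w(n)$, and $w\cdot(i,j)$ denotes right multiplication by the transposition $(i,j)$, i.e. the permutation obtained from $w$ by swapping the values in positions $i$ and $j$. The (strong) Bruhat order: $u\leqslant w$ if, for a reduced decomposition $w=s_{j_1}\cdots s_{j_r}$, $u$ equals a product of a subword $s_{j_{i_1}}\cdots s_{j_{i_k}}$ with $i_1<\dots<i_k$. $w$ covers $w'$ if $w'\leqslant w$ and $\ell(w)=\ell(w')+1$. A (weak) composition is a finite sequence $\alpha=(\alpha_1,\dots,\alpha_m)$ of nonnegative integers, with the convention $\alpha_k=0$ for $k>m$; its weight is $|\alpha|=\sum_k\alpha_k$. The code of $w\in S_n$ is $\mathsf{code}(w)=(\alpha_1,\dots,\alpha_{n-1})$ with $\alpha_i=\#\{k>i : w(k)<w(i)\}$. For a composition $\alpha$, a positive integer $i$ and $j\in\mathbb{N}$, define $c_{i,j}(\alpha)$ recursively in $j$: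 $c_{i,j}(\alpha)=0$ if $j\leqslant i+1$; and for $j>i+1$, $c_{i,j}(\alpha)=c_{i,j-1}(\alpha)+1$ if $\alpha_{j-1}<\alpha_i-c_{i,j-1}(\alpha)$, and $c_{i,j}(\alpha)=c_{i,j-1}(\alpha)$ if $\alpha_{j-1}\geqslant\alpha_i-c_{i,j-1}(\alpha)$. Given compositions $\alpha,\alpha'$ with $|\alpha|=|\alpha'|+1$, we say $\alpha$ covers $\alpha'$ in positions $(i,j)$, where $i<j$ are positive integers, if: (a1) $\alpha'_i\leqslant\alpha_i-1$; (a2) $\alpha'_j=\alpha_j+\alpha_i-\alpha'_i-1$; (a3) $\alpha'_k=\alpha_k$ for all $k\neq i,j$; (a4) $c_{i,j}(\alpha)=c_{i,j}(\alpha')=\alpha'_i-\alpha_j$. *)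

(* Defs.v *)
From mathcomp Require Import all_boot all_order all_fingroup all_algebra.

Set Implicit Arguments.
Unset Strict Implicit.
Unset Printing Implicit Defensive.

(* Permutations of [n] are elements of 'S_n acting on 'I_n = {0, .., n - 1}:
   the position (or value) k of [n] is the ordinal with value k - 1. *)

(* Composition (u v)(k) = u (v k); the library's product goes the other way,
   (u * v)%g k = v (u k).  Thus perm_comp u (tperm a b) is u with the values in
   positions a and b swapped. *)
Definition perm_comp n (u v : 'S_n) : 'S_n := (v * u)%g.

Definition is_simple n (t : 'S_n) : bool :=
  [exists a : 'I_n, exists b : 'I_n,
    (b == a.+1 :> nat) && (t == tperm a b)].

Definition word_prod n (s : seq 'S_n) : 'S_n := foldr (@perm_comp n) 1%g s.

Definition has_word n (w : 'S_n) (k : nat) : bool :=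
  [exists s : k.-tuple 'S_n, all (@is_simple n) s && (word_prod s == w)].

Lemma word_prod_cat n (s t : seq 'S_n) :
  word_prod (s ++ t) = perm_comp (word_prod s) (word_prod t).
Proof.
elim: s => [|u s IHs] /=; first by rewrite /perm_comp mulg1.
by rewrite IHs /perm_comp mulgA.
Qed.

Lemma ex_has_word n (w : 'S_n) : exists k, has_word w k.
Proof.
suff [s sP <-] : exists2 s, all (@is_simple n) s & word_prod s = w.
  by exists (size s); apply/existsP; exists (in_tuple s); rewrite sP /=.
have mulP u v : (exists2 s, all (@is_simple n) s & word_prod s = u) ->
    (exists2 s, all (@is_simple n) s & word_prod s = v) ->
    exists2 s, all (@is_simple n) s & word_prod s = (u * v)%g.
  move=> [s sP <-] [t tP <-]; exists (t ++ s); last by rewrite word_prod_cat.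
  by rewrite all_cat sP tP.
have simpP (a b : 'I_n) : b = a.+1 :> nat ->
    exists2 s, all (@is_simple n) s & word_prod s = tperm a b.
  move=> ab; exists [:: tperm a b]; last by rewrite /= /perm_comp mul1g.
  rewrite /= andbT; apply/existsP; exists a; apply/existsP; exists b.
  by rewrite ab !eqxx.
have ltP d (a b : 'I_n) : b = (a + d).+1 :> nat ->
    exists2 s, all (@is_simple n) s & word_prod s = tperm a b.
  elim: d b => [|d IHd] b ab; first by apply: simpP; rewrite ab addn0.
  have cn : (a + d).+1 < n.
    by apply: ltn_trans (ltn_ord b); rewrite ab addnS.
  pose c := Ordinal cn.
  have -> : tperm a b = (tperm c b * (tperm a c * tperm c b))%g.
    have <- : (tperm a c ^ tperm c b)%g = tperm a b.
      rewrite tpermJ tpermL tpermD // -val_eqE /= ?ab gtn_eqF //.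
        by rewrite ltnS leq_addr.
      by rewrite ltnS leq_addr.
    by rewrite conjgE tpermV.
  have cb : exists2 s, all (@is_simple n) s & word_prod s = tperm c b.
    by apply: simpP; rewrite ab addnS.
  by apply: (mulP _ _ cb); apply: (mulP _ _ _ cb); apply: IHd.
have trP (a b : 'I_n) :
    exists2 s, all (@is_simple n) s & word_prod s = tperm a b.
  case: (ltngtP a b) => [ab|ba|/val_inj ->].
  - by apply: (ltP (b - a).-1); rewrite -addnS prednK ?subn_gt0 // subnKC // ltnW.
  - rewrite tpermC; apply: (ltP (a - b).-1).
    by rewrite -addnS prednK ?subn_gt0 // subnKC // ltnW.
  - by exists [::] => //=; rewrite tperm1.
have [ts -> _] := prod_tpermP w.
elim: ts => [|t ts IHts]; first by exists [::]; rewrite //= big_nil.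
by rewrite big_cons; apply: mulP.
Qed.

Definition perm_length n (w : 'S_n) : nat := ex_minn (ex_has_word w).

Definition reduced_word n (w : 'S_n) (s : seq 'S_n) : Prop :=
  [/\ all (@is_simple n) s, word_prod s = w & size s = perm_length w].

Definition bruhat_le n (u w : 'S_n) : Prop :=
  exists s : seq 'S_n, reduced_word w s /\
    exists t : seq 'S_n, subseq t s /\ word_prod t = u.

Definition bruhat_covers n (w w' : 'S_n) : Prop :=
  bruhat_le w' w /\ perm_length w = perm_length w' + 1.

(* The entry alpha_k, 1-indexed, with alpha_k = 0 for k > size alpha; only
   meaningful for k >= 1. *)
Definition part (alpha : seq nat) (k : nat) : nat := nth 0 alpha k.-1.

(* The code has n - 1 entries; widen_ord embeds 'I_n.-1 into 'I_n. *)
Definition code n (w : 'S_n) : seq nat :=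
  [seq #|[set k : 'I_n | (p < k) && (w k < w (widen_ord (leq_pred n) p))]|
  | p : 'I_n.-1 <- enum 'I_n.-1].

(* c_{i,j}(alpha), by recursion on j.  Truncated subtraction is harmless here:
   for naturals, x < a - c holds in nat iff it holds in the integers. *)
Fixpoint ccoef (i j : nat) (alpha : seq nat) : nat :=
  if j is j'.+1 then
    if j <= i + 1 then 0
    else if part alpha j' < part alpha i - ccoef i j' alpha
         then ccoef i j' alpha + 1
         else ccoef i j' alpha
  else 0.

(* The equations are stated in the integers, since subtractions on nat would
   be truncated (e.g. alpha'_i <= alpha_i - 1 when alpha_i = 0). *)
Definition composition_covers (alpha alpha' : seq nat) (i j : nat) : Prop :=
  sumn alpha = sumn alpha' + 1 /\
  [/\ ((part alpha' i)%:Z <= (part alpha i)%:Z - 1)%R,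
      ((part alpha' j)%:Z
        = (part alpha j)%:Z + (part alpha i)%:Z - (part alpha' i)%:Z - 1)%R,
      (forall k : nat, 0 < k -> k <> i -> k <> j ->
        part alpha' k = part alpha k)
    & ccoef i j alpha = ccoef i j alpha' /\
      ((ccoef i j alpha')%:Z = (part alpha' i)%:Z - (part alpha j)%:Z)%R].

(* Main.v *)
(** If [w] has code [alpha], then [c_{i,j}(alpha)] counts the positions
    [i < k < j] with [w k < w i], and [w j < w i] iff
    [alpha_j < alpha_i - c_{i,j}(alpha)].  Hence the code determines the relative
    order of all values, so it is injective; and (a1)-(a4) hold for
    [w' = w (i,j)] as soon as [w j < w i] with no intermediate value in between.
    Conversely, under (a1)-(a4) the difference of the [c_{i,k}] for [alpha] and
    [alpha'] is monotone in [k] and vanishes at both ends, so it vanishes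
    throughout; applied to the last position [k] carrying an intermediate value,
    this bounds [alpha_k] by less than what the definition of the code gives.
    The Bruhat condition reduces to the same "no intermediate value" condition
    because the length is the sum of the code, and because deleting a letter
    from a word realizes [w (i,j)] whenever [w j < w i]. *)
Require Import Defs.
From mathcomp Require Import all_boot all_order all_fingroup all_algebra.
From mathcomp Require Import zify.

Set Implicit Arguments.
Unset Strict Implicit.
Unset Printing Implicit Defensive.

(** * Comparing the coefficients of two compositions *)

Lemma ccoef_le i m alpha : m <= i.+1 -> ccoef i m alpha = 0.
Proof. by case: m => //= m; rewrite addn1 => ->. Qed.

Lemma ccoefS i m alpha : i < m ->
  ccoef i m.+1 alpha
  = ccoef i m alpha + (part alpha m < part alpha i - ccoef i m alpha).
Proof.
move=> im /=; rewrite addn1 ltnS leqNgt im /=.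
by case: ifP; rewrite ?addn0.
Qed.

(** The threshold of [alpha] stays at least that of [alpha'], so [alpha] counts whatever [alpha']
    counts; an extra count needs a strict gap, which pays for it. *)
Lemma ccoef_compare alpha alpha' i j :
  part alpha' i <= part alpha i ->
  (forall k, i < k < j -> part alpha' k = part alpha k) ->
  ccoef i j alpha' <= ccoef i j alpha /\
  part alpha' i + ccoef i j alpha <= part alpha i + ccoef i j alpha'.
Proof.
move=> le_i; elim: j => [|j IHj] eq_k; first by rewrite /=; lia.
have [le_ji|lt_ij] := leqP j i; first by rewrite !ccoef_le ?ltnS //; lia.
have [|IH1 IH2] := IHj; first by move=> k ?; apply: eq_k; lia.
have := eq_k j; rewrite lt_ij ltnSn => /(_ isT) e.
by rewrite !ccoefS // e; lia.
Qed.

(** The gap between the two coefficients starts at 0 and never decreases, so vanishing at [j] forces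
    it to vanish before. *)
Lemma ccoef_eq_prefix alpha alpha' i j :
  part alpha' i <= part alpha i ->
  (forall k, i < k < j -> part alpha' k = part alpha k) ->
  ccoef i j alpha = ccoef i j alpha' ->
  forall k, k <= j -> ccoef i k alpha = ccoef i k alpha'.
Proof.
move=> le_i; elim: j => [|j IHj] eq_k eq_c k; first by case: k.
rewrite leq_eqVlt => /predU1P[-> //|]; rewrite ltnS => le_kj.
have [le_ji|lt_ij] := leqP j i; first by rewrite !ccoef_le //; lia.
have eq_k' l : i < l < j -> part alpha' l = part alpha l.
  by move=> ?; apply: eq_k; lia.
apply: IHj => //.
have [IH1 IH2] := ccoef_compare le_i eq_k'.
have := eq_k j; rewrite lt_ij ltnSn => /(_ isT) e.
by move: eq_c; rewrite !ccoefS // e; lia.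
Qed.

Lemma sum_ord_split n (F : 'I_n -> nat) (p q : 'I_n) : p < q ->
  \sum_(k < n | p < k) F k
  = \sum_(k < n | p < k < q) F k + F q + \sum_(k < n | q < k) F k.
Proof.
move=> pq; rewrite (bigID (fun k : 'I_n => k < q)) /= -addnA; congr addn.
rewrite (bigD1 q) /= ?pq ?ltnn //; congr addn.
by apply: eq_bigl => k; rewrite -val_eqE /=; lia.
Qed.

(** * Codes and the relative order of values *)

Section Code.

Variable n : nat.
Implicit Types (w : 'S_n) (a b p q k : 'I_n).

Definition inv_from w p : nat := \sum_(k < n | p < k) (w k < w p).

Definition inv_between w p (m : nat) : nat :=
  \sum_(k < n | p < k < m) (w k < w p).

Lemma codeE w : code w = mkseq (fun m => part (code w) m.+1) n.-1.
Proof.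
apply: (@eq_from_nth _ 0); first by rewrite size_mkseq size_map size_enum_ord.
move=> m; rewrite size_map size_enum_ord => mn.
by rewrite nth_mkseq.
Qed.

Lemma part_code_out w m : n <= m -> part (code w) m = 0.
Proof.
by move=> nm; rewrite /part nth_default // size_map size_enum_ord; lia.
Qed.

Lemma part_code w p : part (code w) p.+1 = inv_from w p.
Proof.
(* The last position has no entry; the default 0 is right, since nothing follows it. *)
have [np|pn] := leqP n.-1 p.
  rewrite part_code_out; last by lia.
  rewrite /inv_from big_pred0 // => k; have := ltn_ord k; lia.
rewrite /part /= (nth_map (Ordinal pn)) ?size_enum_ord // /inv_from.
rewrite -sum1dep_card -[RHS]big_mkcondr /=.
have -> : widen_ord (leq_pred n) (nth (Ordinal pn) (enum 'I_n.-1) p) = p.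
  by apply: val_inj; rewrite /= nth_enum_ord.
by rewrite nth_enum_ord.
Qed.

Lemma sumn_code w : sumn (code w) = \sum_(p < n) inv_from w p.
Proof.
rewrite codeE sumnE big_map.
have -> : iota 0 n.-1 = index_iota 0 n.-1 by rewrite /index_iota subn0.
under [RHS]eq_bigr do rewrite -part_code.
rewrite -(big_mkord xpredT (fun m => part (code w) m.+1)).
rewrite [RHS](@big_cat_nat _ _ _ n.-1) ?leq_pred //= [X in _ + X]big1_seq ?addn0 //.
by move=> m /andP[_]; rewrite mem_index_iota => mn; rewrite part_code_out; lia.
Qed.

Lemma inv_fromE w p q : p < q ->
  inv_from w p = inv_between w p q + (w q < w p)
                 + \sum_(k < n | q < k) (w k < w p).
Proof. exact: sum_ord_split. Qed.

(** The difference counts the positions from [q] on with values below [w p]. If [w q < w p], these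
    include [q] and all that [inv_from w q] counts; otherwise they are among the latter. *)
Lemma ltn_perm_code w p q : p < q ->
  (w q < w p) = (inv_from w q < inv_from w p - inv_between w p q).
Proof.
move=> pq; rewrite (inv_fromE w pq).
have neq : w q <> w p :> nat by move/val_inj/perm_inj=> e; rewrite e ltnn in pq.
case: (ltngtP (w q) (w p)) => // [lt_qp|lt_pq].
- have : inv_from w q <= \sum_(k < n | q < k) (w k < w p).
    by apply: leq_sum => k _; lia.
  lia.
- have : \sum_(k < n | q < k) (w k < w p) <= inv_from w q.
    by apply: leq_sum => k _; lia.
  lia.
Qed.

Lemma inv_betweenS w p q : p < q ->
  inv_between w p q.+1 = inv_between w p q + (w q < w p).
Proof.
move=> pq; rewrite /inv_between (bigD1 q) /= ?pq ?ltnSn // addnC; congr addn.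
by apply: eq_bigl => k; rewrite -val_eqE /=; lia.
Qed.

Lemma inv_between_out w p m : n <= m -> inv_between w p m = inv_from w p.
Proof. by move=> nm; apply: eq_bigl => k; have := ltn_ord k; lia. Qed.

Lemma ccoef_code w p m :
  ccoef p.+1 m.+1 (code w) = inv_between w p m.
Proof.
elim: m => [|m IHm]; first by rewrite ccoef_le // /inv_between big_pred0 // => k; lia.
have [le_mp|lt_pm] := leqP m p.
  by rewrite ccoef_le ?ltnS // /inv_between big_pred0 // => k; lia.
rewrite ccoefS ?ltnS // IHm part_code.
(* Past the end every smaller value is already counted, so the threshold is 0 and the padding zeros
   add nothing. *)
have [nm|mn] := leqP n m.
  by rewrite !inv_between_out ?leqW // subnn ltn0 addn0.
by rewrite (part_code w (Ordinal mn)) -(@ltn_perm_code w p (Ordinal mn)) //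
  (@inv_betweenS w p (Ordinal mn)).
Qed.

Lemma sum_ltn_perm w p : \sum_(k < n) (w k < w p) = w p.
Proof.
transitivity (\sum_(k < n) (k < w p)); first by rewrite [RHS](reindex_perm w).
rewrite -[LHS]big_mkcond /=.
rewrite -(big_ord_widen _ (fun=> 1)); last exact: ltnW.
by rewrite sum1_card card_ord.
Qed.

(** A value equals the number of smaller values, so the relative order read off the code determines
    the permutation. *)
Lemma code_inj : injective (@code n).
Proof.
move=> w w' eq_code.
have lt_eq p q : p < q -> (w q < w p) = (w' q < w' p).
  by move=> pq; rewrite !ltn_perm_code // -!part_code -!ccoef_code eq_code.
apply/permP => p; apply: val_inj; rewrite /= -(sum_ltn_perm w) -(sum_ltn_perm w').
apply: eq_bigr => k _; case: (ltngtP k p) => [kp|pk|/val_inj ->].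
- have neq (v : 'S_n) : v k <> v p :> nat.
    by move/val_inj/perm_inj=> e; rewrite e ltnn in kp.
  have := lt_eq _ _ kp; have := neq w; have := neq w'; lia.
- by rewrite lt_eq.
- by rewrite !ltnn.
Qed.

(** * Effect of a swap on the code *)

Lemma perm_compE (u v : 'S_n) k : perm_comp u v k = u (v k).
Proof. exact: permM. Qed.

Lemma perm_comp_tpermK w a b :
  perm_comp (perm_comp w (tperm a b)) (tperm a b) = w.
Proof. by rewrite /perm_comp mulgA tperm2 mul1g. Qed.

(** For [p] before [a] the swap only permutes the counted positions; for [p] after [a] only the
    value at [b] can change, which the hypothesis covers. *)
Lemma inv_from_swap w a b p : a < b -> p != a -> p != b ->
  (a < p < b -> (w a < w p) = (w b < w p)) ->
  inv_from (perm_comp w (tperm a b)) p = inv_from w p.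
Proof.
move=> ab pa pb gap_p.
have wp : perm_comp w (tperm a b) p = w p.
  by rewrite perm_compE tpermD // eq_sym.
have [lt_pa|le_ap] := ltnP p a.
  rewrite /inv_from [RHS](reindex_perm (tperm a b)) /= wp.
  apply: eq_big => [k|k _]; last by rewrite perm_compE.
  by case: tpermP => [->|->|//]; lia.
have {le_ap} lt_ap : a < p by rewrite ltn_neqAle le_ap andbT eq_sym.
apply: eq_bigr => k pk; rewrite wp perm_compE.
case: tpermP pk => [->|-> pk|//]; first by lia.
by rewrite gap_p ?lt_ap.
Qed.

Definition no_value_between w a b :=
  forall k, a < k < b -> ~~ (w b < w k < w a).

Section Swap.

Variables (w : 'S_n) (a b : 'I_n).
Hypotheses (ab : a < b) (lt_w : w b < w a).
Let u := perm_comp w (tperm a b).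

Let ua : u a = w b. Proof. by rewrite perm_compE tpermL. Qed.
Let ub : u b = w a. Proof. by rewrite perm_compE tpermR. Qed.
Let uk k : k != a -> k != b -> u k = w k.
Proof. by move=> ka kb; rewrite perm_compE tpermD // eq_sym. Qed.

Hypothesis gap : no_value_between w a b.

Let gap_lt k : a < k < b -> (w k < w b) = (w k < w a).
Proof.
move=> akb; have := gap akb.
have : w k <> w b :> nat by move/val_inj/perm_inj=> e; move: akb; rewrite e; lia.
by lia.
Qed.

Lemma inv_from_swap_between p : p != a -> p != b -> inv_from u p = inv_from w p.
Proof.
move=> pa pb; apply: inv_from_swap => // apb; have := gap_lt apb.
have neq q : q != p -> w q <> w p :> nat.
  by move=> qp /val_inj/perm_inj/eqP; rewrite (negbTE qp).
have := neq a; have := neq b; rewrite ![_ == p]eq_sym pa pb.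
by move=> /(_ isT) ? /(_ isT) ?; lia.
Qed.

Lemma inv_between_swap : inv_between u a b = inv_between w a b.
Proof.
apply: eq_bigr => k akb; rewrite ua uk ?gap_lt // -val_eqE /=; lia.
Qed.

Lemma inv_from_swap_left : inv_from u a = inv_between w a b + inv_from w b.
Proof.
rewrite (inv_fromE _ ab) inv_between_swap ua ub ltnNge ltnW // addn0.
by congr addn; apply: eq_bigr => k bk; rewrite uk // -val_eqE /=; lia.
Qed.

Lemma inv_from_swap_right :
  inv_from w a = inv_between w a b + 1 + inv_from u b.
Proof.
rewrite (inv_fromE _ ab) lt_w; congr addn.
by apply: eq_bigr => k bk; rewrite ub uk // -val_eqE /=; lia.
Qed.

Lemma sumn_code_swap : sumn (code w) = sumn (code u) + 1.
Proof.
have ba : b != a by rewrite -val_eqE /=; lia.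
rewrite !sumn_code (bigD1 a) //= (bigD1 b) //=.
rewrite [in RHS](bigD1 a) //= [in RHS](bigD1 b) //=.
rewrite [in RHS](eq_bigr (inv_from w)).
  by rewrite inv_from_swap_right inv_from_swap_left; lia.
by move=> k /andP[ka kb]; apply: inv_from_swap_between.
Qed.

End Swap.

Lemma tperm_tripleE a k b : a != k -> k != b -> a != b ->
  tperm a b = (tperm a k * tperm k b * tperm a k)%g.
Proof.
move=> ak kb ab; rewrite -mulgA -{1}[tperm a k]tpermV -conjgE tpermJ tpermR.
by rewrite tpermD // eq_sym.
Qed.

(* With values x > y > z in positions a < k < b, the swap of a and b is the
   product of the swaps of (a,k), (k,b), (a,k), each of which removes an
   inversion. *)
Lemma swap_triple w a k b : a < k < b ->
  perm_comp w (tperm a b)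
  = perm_comp (perm_comp (perm_comp w (tperm a k)) (tperm k b)) (tperm a k).
Proof.
move=> akb; rewrite (@tperm_tripleE a k b) -?val_eqE /=; try by lia.
by rewrite /perm_comp !mulgA.
Qed.

(** Induction on [b - a]: an intermediate value splits the swap into three shorter ones, each
    lowering the sum, for a drop of at least 3; otherwise the drop is exactly 1. *)
Lemma sumn_code_swap_lt w a b : a < b -> w b < w a ->
  sumn (code (perm_comp w (tperm a b))) < sumn (code w)
  /\ (~ no_value_between w a b ->
      sumn (code (perm_comp w (tperm a b))) + 2 < sumn (code w)).
Proof.
move: {2}(b - a).+1 (ltnSn (b - a)) => d.
elim: d w a b => // d IHd w a b le_d ab lt_w.
have [/existsP[k /andP[akb wk]]|/existsPn gap] :=
  boolP [exists k : 'I_n, (a < k < b) && (w b < w k < w a)]; last first.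
  have gap' : no_value_between w a b.
    by move=> k akb; move: (gap k); rewrite akb.
  by split => //; rewrite (sumn_code_swap ab lt_w gap') addn1.
suff H : sumn (code (perm_comp w (tperm a b))) + 2 < sumn (code w).
  by split => //; lia.
have [na nb] : a != k /\ k != b by rewrite -!val_eqE /=; lia.
have ba : a != b by rewrite -val_eqE /=; lia.
rewrite (swap_triple w akb).
set w1 := perm_comp w (tperm a k); set w2 := perm_comp w1 (tperm k b).
have [H1 _] : _ := IHd w a k ltac:(lia) ltac:(lia) ltac:(lia).
have [||H2 _] := IHd w1 k b ltac:(lia).
- lia.
- by rewrite !perm_compE tpermR tpermD // 1?eq_sym.
have [||H3 _] := IHd w2 a k ltac:(lia).
- lia.
- have -> : w2 k = w b by rewrite !perm_compE tpermL tpermD // eq_sym.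
  have -> : w2 a = w k by rewrite !perm_compE [tperm k b a]tpermD 1?eq_sym // tpermL.
  by lia.
move: H1 H2 H3; rewrite -/w1 -/w2; lia.
Qed.

(** * Length as the sum of the code, and Bruhat covers *)

Lemma sumn_code_simple w t : is_simple t ->
  sumn (code (perm_comp w t)) <= (sumn (code w)).+1.
Proof.
case/existsP => a /existsP[b /andP[/eqP ab /eqP ->]].
have lt_ab : a < b by rewrite ab.
have gap v : no_value_between v a b by move=> k; lia.
case: (ltngtP (w a) (w b)) => [lt_w|gt_w|/val_inj/perm_inj e].
- have -> : w = perm_comp (perm_comp w (tperm a b)) (tperm a b).
    by rewrite perm_comp_tpermK.
  rewrite perm_comp_tpermK (@sumn_code_swap (perm_comp w (tperm a b)) a b) //.
    by rewrite addn1.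
  by rewrite !perm_compE tpermL tpermR.
- by rewrite [X in _ <= X.+1](sumn_code_swap lt_ab gt_w (gap w)); lia.
- by rewrite e ltnn in lt_ab.
Qed.

Lemma sumn_code1 : sumn (code (1%g : 'S_n)) = 0.
Proof.
rewrite sumn_code big1 // => p _; rewrite /inv_from big1 // => k.
by rewrite !perm1; lia.
Qed.

Lemma sumn_code_word s : all (@is_simple n) s ->
  sumn (code (word_prod s)) <= size s.
Proof.
elim/last_ind: s => [|s t IHs]; first by rewrite sumn_code1.
rewrite all_rcons size_rcons => /andP[t_simple /IHs le_s].
rewrite -cats1 word_prod_cat /= {2}/perm_comp mul1g.
by apply: leq_trans (sumn_code_simple _ t_simple) _.
Qed.

Lemma perm1_of_no_descent w :
  (forall a b, b = a.+1 :> nat -> w a < w b) -> w = 1%g.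
Proof.
move=> asc.
have mono a b : a < b -> w a < w b.
  move: {2}(b - a).+1 (ltnSn (b - a)) => d.
  elim: d b => // d IHd b le_d ab.
  have [e|ne] := eqVneq (b : nat) a.+1; first exact: asc.
  have cn : b.-1 < n by have := ltn_ord b; lia.
  apply: (@ltn_trans (w (Ordinal cn))); first by apply: IHd => /=; lia.
  by apply: asc => /=; lia.
apply/permP => p; apply: val_inj; rewrite /= -(sum_ltn_perm w).
rewrite -[RHS](sum_ltn_perm 1%g); apply: eq_bigr => k _; rewrite !perm1.
case: (ltngtP k p) => [/mono -> //|/mono|/val_inj ->]; last by rewrite ltnn.
by lia.
Qed.

(** Sorting by adjacent swaps: each removed descent lowers the sum by 1, and only the identity has
    no descent. *)
Lemma ex_word_sumn_code w : exists2 s, all (@is_simple n) s &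
  word_prod s = w /\ size s = sumn (code w).
Proof.
move: {2}(sumn _) (leqnn (sumn (code w))) => m.
elim: m w => [|m IHm] w le_m.
all: have [/existsP[a /existsP[b /andP[/eqP ab lt_w]]]|/existsPn no_desc] :=
  boolP [exists a : 'I_n, exists b : 'I_n, (b == a.+1 :> nat) && (w b < w a)].
1,3: have lt_ab : a < b by rewrite ab.
1,2: have gap : no_value_between w a b by move=> k; lia.
1,2: have := sumn_code_swap lt_ab lt_w gap.
- by lia.
- move=> e; have [s s_simple [s_prod s_size]] :=
    IHm (perm_comp w (tperm a b)) ltac:(lia).
  exists (rcons s (tperm a b)).
    rewrite all_rcons s_simple andbT; apply/existsP; exists a.
    by apply/existsP; exists b; rewrite ab !eqxx.
  rewrite -cats1 word_prod_cat /= {2}/perm_comp mul1g s_prod perm_comp_tpermK.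
  by rewrite cats1 size_rcons s_size e addn1.
all: exists [::] => //=; rewrite (@perm1_of_no_descent w) ?sumn_code1 // => a b ab.
all: move/existsPn/(_ b): (no_desc a); rewrite ab eqxx /= -leqNgt.
all: rewrite leq_eqVlt => /orP[/eqP/val_inj/perm_inj e|//].
all: by move: ab; rewrite e; lia.
Qed.

Lemma perm_lengthE w : perm_length w = sumn (code w).
Proof.
rewrite /perm_length; case: ex_minnP => m /existsP[t /andP[t_simple /eqP t_prod]].
have [s s_simple [s_prod s_size]] := ex_word_sumn_code w => min_m.
apply/eqP; rewrite eqn_leq; apply/andP; split.
  apply: min_m; apply/existsP; rewrite -s_size; exists (in_tuple s).
  by rewrite s_simple /= s_prod.
by have := sumn_code_word t_simple; rewrite t_prod size_tuple.
Qed.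

(* Strong exchange: along the suffixes of the word, the values in positions a
   and b must cross; the letter at which they do is the one to delete. *)
Lemma word_exchange s a b : all (@is_simple n) s -> a < b ->
  word_prod s b < word_prod s a ->
  exists2 t, subseq t s & word_prod t = perm_comp (word_prod s) (tperm a b).
Proof.
move=> + ab; elim: s => [|x s IHs] /=; first by rewrite !perm1; lia.
case/andP=> x_simple s_simple lt_xs.
case: (ltngtP (word_prod s a) (word_prod s b)) => [lt_s|gt_s|/val_inj/perm_inj e].
- exists s; first exact: subseq_cons.
  case/existsP: x_simple lt_xs => c /existsP[d /andP[/eqP cd /eqP ->]].
  rewrite !perm_compE => lt_xs.
  have ne (y z : 'I_n) : y <> z -> y <> z :> nat by move=> yz /val_inj.
  (* An adjacent transposition of values reverses only the two values it exchanges; by conjugation,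
     [x] then acts as the swap of [a] and [b]. *)
  have [/val_inj -> /val_inj ->] :
      c = word_prod s a :> nat /\ d = word_prod s b :> nat.
    move: lt_xs lt_s; case: tpermP => [->|->|/ne n1 /ne n2];
      case: tpermP => [->|->|/ne n3 /ne n4]; lia.
  by rewrite /perm_comp -tpermJ -conjgC mulgA tperm2 mul1g.
- have [t t_sub t_prod] := IHs s_simple gt_s.
  by exists (x :: t); rewrite /= ?eqxx // t_prod /perm_comp mulgA.
- by rewrite e ltnn in ab.
Qed.

(** A length drop of exactly 1 rules out an ascent, where the swap lengthens, and an intermediate
    value, which costs at least 3. *)
Lemma bruhat_coversP w a b : a < b ->
  bruhat_covers w (perm_comp w (tperm a b))
  <-> w b < w a /\ no_value_between w a b.
Proof.
move=> ab; rewrite /bruhat_covers !perm_lengthE; split=> [[_ len_w]|[lt_w gap]].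
  case: (ltngtP (w a) (w b)) => [lt_w|gt_w|/val_inj/perm_inj e].
  - have [|+ _] := @sumn_code_swap_lt (perm_comp w (tperm a b)) a b ab.
      by rewrite !perm_compE tpermL tpermR.
    by rewrite perm_comp_tpermK; lia.
  - split=> // k akb; apply/negP => wk.
    have [_ lt2] := sumn_code_swap_lt ab gt_w.
    have /lt2 : ~ no_value_between w a b by move/(_ k akb); rewrite wk.
    by lia.
  - by rewrite e ltnn in ab.
split; last exact: sumn_code_swap.
have [s s_simple [s_prod s_size]] := ex_word_sumn_code w.
exists s; split; first by split=> //; rewrite perm_lengthE.
have [|t t_sub t_prod] := word_exchange s_simple ab; first by rewrite s_prod.
by exists t; rewrite t_prod s_prod.
Qed.

(** * Covers of compositions *)

Lemma composition_covers_swap w a b : a < b -> w b < w a ->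
  no_value_between w a b ->
  composition_covers (code w) (code (perm_comp w (tperm a b))) a.+1 b.+1.
Proof.
move=> ab lt_w gap.
have Hl := inv_from_swap_left ab lt_w gap.
have Hr := inv_from_swap_right ab lt_w.
have Hb := inv_between_swap ab lt_w gap.
have := lt_w; rewrite ltn_perm_code // => Hlt.
split; first exact: sumn_code_swap.
rewrite !ccoef_code !part_code; split; try by lia.
move=> [//|m] _ ma mb; have [nm|mn] := leqP n m; first by rewrite !part_code_out ?leqW.
rewrite !(part_code _ (Ordinal mn)).
apply: inv_from_swap_between => //; apply/eqP => e.
  by apply: ma; rewrite -e.
by apply: mb; rewrite -e.
Qed.

(** If [j] exceeded [n], the coefficients would be the full entries at [i], equal by (a4), against
    (a1). *)
Lemma composition_covers_range w w' i j : 0 < i -> i < j ->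
  composition_covers (code w) (code w') i j -> j <= n.
Proof.
case: i j => [//|a] [//|m] _ am [_ [a1 a2 _ [c1 c2]]].
have [lt_an|le_na] := ltnP a n; last first.
  by move: a1; rewrite !part_code_out ?leqW //; lia.
rewrite ltnNge; apply/negP => le_nm.
rewrite -[a]/(nat_of_ord (Ordinal lt_an)) in a1 a2 c1 c2.
move: a1 a2 c1 c2; rewrite !ccoef_code !part_code !part_code_out ?leqW //.
by rewrite !inv_between_out //; lia.
Qed.

(** With [c] the common coefficient, (a4) and (a1) give [alpha_j = alpha'_i - c < alpha_i - c]. *)
Lemma composition_covers_lt w w' a b : a < b ->
  composition_covers (code w) (code w') a.+1 b.+1 -> w b < w a.
Proof.
move=> ab [_ [a1 a2 _ [c1 c2]]]; rewrite ltn_perm_code //.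
by move: a1 a2 c1 c2; rewrite !ccoef_code !part_code; lia.
Qed.

Lemma composition_covers_no_value w w' a b : a < b ->
  composition_covers (code w) (code w') a.+1 b.+1 -> no_value_between w a b.
Proof.
move=> ab cov; have lt_w := composition_covers_lt ab cov.
case: cov => _ [a1 a2 a3 [c1 c2]].
have eq_c : forall k : 'I_n, k <= b -> inv_between w a k = inv_between w' a k.
  move=> k kb; rewrite -!ccoef_code.
  apply: (ccoef_eq_prefix (j := b.+1)) => //; first by lia.
  by move=> l /andP[al lb]; apply: a3; lia.
(* Whether [w k < w a] is the increment of the coefficient at [k]. *)
have lt_eq k : a < k < b -> (w k < w a) = (w' k < w' a).
  case/andP=> ak kb; have := ltn_ord b => bn.
  have kn : k.+1 < n by lia.
  have := eq_c (Ordinal kn) kb; have := eq_c k (ltnW kb).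
  by rewrite /= !inv_betweenS //; lia.
suff none k : a < k < b -> ~~ (w b < w k < w a) by [].
(* Descending induction on [k], through a bound on [b - k]. *)
move: {2}(b - k) (leqnn (b - k)) => d.
elim: d k => [|d IHd] k le_d akb; first by lia.
apply/negP => /andP[bk ka]; have /andP[ak kb] := akb.
(* Only positions after k matter: by induction none of them carries an
   intermediate value, so between k and b "below w a" means "below w k". *)
have eq_below (l : 'I_n) : k < l < b -> (w l < w k) = (w l < w a).
  move=> klb; have := IHd l ltac:(lia) ltac:(lia).
  have : w l <> w b :> nat by move/val_inj/perm_inj=> e; move: klb; rewrite e; lia.
  by lia.
have w'ka : w' k < w' a by rewrite -lt_eq.
rewrite ltn_perm_code // in w'ka.
have eq_k : inv_from w' k = inv_from w k.
  by rewrite -!part_code; apply: a3; lia.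
have split_c (v : 'S_n) : inv_between v a b
    = inv_between v a k + (v k < v a) + \sum_(l < n | k < l < b) (v l < v a).
  rewrite -inv_betweenS // /inv_between.
  rewrite (bigID (fun l : 'I_n => l < k.+1)) /=; congr addn;
    by apply: eq_bigl => l; lia.
have le_k : \sum_(l < n | k < l < b) (w l < w a) + 1 + inv_from w b <= inv_from w k.
  rewrite (inv_fromE _ kb) bk.
  have -> : inv_between w k b = \sum_(l < n | k < l < b) (w l < w a).
    by apply: eq_bigr => l klb; rewrite eq_below.
  by rewrite leq_add2l; apply: leq_sum => l _; lia.
(* With [N] positions between [k] and [b] below [w a], (a4) and [w' k < w' a] put the entry at [k]
   strictly below [inv_from w b + 1 + N], against [le_k]. *)
move: c2 (split_c w) (eq_c k (ltnW kb)) (eq_c b (leqnn b)) w'ka le_k.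
rewrite ccoef_code !part_code ka eq_k; lia.
Qed.

(** The swap satisfies the same equations, and these fix every entry: at [a] by (a4), at [b] by
    (a2), elsewhere by (a3). *)
Lemma composition_covers_swap_eq w w' a b : a < b ->
  composition_covers (code w) (code w') a.+1 b.+1 ->
  w' = perm_comp w (tperm a b).
Proof.
move=> ab cov; have lt_w := composition_covers_lt ab cov.
have gap := composition_covers_no_value ab cov.
have := composition_covers_swap ab lt_w gap.
case: cov => _ [a1 a2 a3 [c1 c2]] [_ [u1 u2 u3 [e1 e2]]].
apply: code_inj; rewrite [LHS]codeE [RHS]codeE; apply/eq_mkseq => m.
have [->|/eqP ma] := eqVneq m a; first by lia.
have [->|/eqP mb] := eqVneq m b; first by lia.
by rewrite a3 ?u3 //; case.
Qed.

End Code.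

Theorem theorem4p3 (n : nat) (hn : 1 <= n) (w w' : 'S_n)
    (i j : nat) (hi : 1 <= i) (hij : i < j) :
  (bruhat_covers w w' /\
   exists a b : 'I_n, [/\ i = a.+1, j = b.+1 & w' = perm_comp w (tperm a b)])
  <-> composition_covers (code w) (code w') i j.
Proof.
split=> [[cov [a [b [ia jb w'E]]]]|cov].
  move: hij cov; rewrite ia jb w'E ltnS => ab /(bruhat_coversP _ ab)[lt_w gap].
  exact: composition_covers_swap.
have le_jn := composition_covers_range hi hij cov.
case: i j hi hij cov le_jn => [//|i] [//|j] _ ij cov jn.
have iN : i < n by exact: leq_trans (ltnW ij) jn.
have w'E : w' = perm_comp w (tperm (Ordinal iN) (Ordinal jn)).
  exact: (@composition_covers_swap_eq _ w w' (Ordinal iN) (Ordinal jn)).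
split; last by exists (Ordinal iN), (Ordinal jn).
rewrite w'E; apply/bruhat_coversP => //; split.
  exact: (@composition_covers_lt _ w w' (Ordinal iN) (Ordinal jn)).
exact: (@composition_covers_no_value _ w w' (Ordinal iN) (Ordinal jn)).
Qed.
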